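(* Let $X$ be a real Banach space, $\mathcal D$ a dictionary in $X$, and $\tau=\{t_m\}_{m=1}^\infty$, $t_m\in[0,1]$, a weakness sequence. Then the Weak Chebyshev Greedy Algorithm (WCGA), the Weak Greedy Algorithm with Free Relaxation (WGAFR), and the Rescaled Weak Relaxed Greedy Algorithm (RWRGA) belong to the class $\mathcal{WBGA}$ of Weak Biorthogonal Greedy Algorithms.
   Context: A dictionary in a real Banach space $X$ is a set $\mathcal D\subset X$ such that $\|g\|\le 1$ for all $g\in\mathcal D$, the closed linear span of $\mathcal D$ is $X$, and $g\in\mathcal D$ implies $-g\in\mathcal D$. For a nonzero $h\in X$, $F_h$ denotes a norming functional of $h$: $F_h\in X'$, $\|F_h\|=1$, $F_h(h)=\|h\|$. For $F\in X'$, $\|F\|_{\mathcal D}:=\sup_{g\in\mathcal D}F(g)$. Class $\mathcal{WBGA}$: an algorithm with weakness sequence $\tau$, applied to a target $f\in X$, belongs to $\mathcal{WBGA}$ if the selected elements $\varphi_m\in\mathcal D$, the approximants $G_m\in\operatorname{span}\{\varphi_1,\dots,\varphi_m\}$ and the remainders $f_m=f-G_m$ (with $f_0=f$, $G_0=0$) satisfy for every $m\ge1$: (1) Greedy selection: $F_{f_{m-1}}(\varphi_m)\ge t_m\|F_{f_{m-1}}\|_{\mathcal D}$; (2) Error reduction: $\|f_m\|\le\inf_{\lambda\ge0}\|f_{m-1}-\lambda\varphi_m\|$; (3) Biorthogonality: $F_{f_m}(G_m)=0$. Norming functionals are defined only for nonzero elements, so conditions involving $F_{f_k}$ are understood for $f_k\ne0$.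 All three algorithms start with $f_0:=f$, $G_0:=0$, and at each iteration $m\ge1$ take any $\varphi_m\in\mathcal D$ with $F_{f_{m-1}}(\varphi_m)\ge t_m\|F_{f_{m-1}}\|_{\mathcal D}$, construct $G_m$ as below, and set $f_m:=f-G_m$: - WCGA: $G_m\in\Phi_m:=\operatorname{span}\{\varphi_1,\dots,\varphi_m\}$ is such that $\|f-G_m\|=\inf_{G\in\Phi_m}\|f-G\|$. - WGAFR: find $\omega_m\in\mathbb R$ and $\lambda_m\ge0$ such that $\|f-((1-\omega_m)G_{m-1}+\lambda_m\varphi_m)\|=\inf_{\lambda\ge0,\,\omega\in\mathbb R}\|f-((1-\omega)G_{m-1}+\lambda\varphi_m)\|$, and define $G_m:=(1-\omega_m)G_{m-1}+\lambda_m\varphi_m$. - RWRGA: find $\lambda_m\ge0$ with $\|f_{m-1}-\lambda_m\varphi_m\|=\inf_{\lambda\ge0}\|f_{m-1}-\lambda\varphi_m\|$; then find $\mu_m\in\mathbb R$ with $\|f-\mu_m(G_{m-1}+\lambda_m\varphi_m)\|=\inf_{\mu\in\mathbb R}\|f-\mu(G_{m-1}+\lambda_m\varphi_m)\|$, and define $G_m:=\mu_m(G_{m-1}+\lambda_m\varphi_m)$.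
   Formalization: The norming functional F_h is read as ''some norming functional of h'', chosen separately in greedy selection and in biorthogonality; with one fixed F_h the claim fails in non-smooth spaces, and the readings agree when norming functionals are unique. *)

(* Defs.v *)
From HB Require Import structures.
From mathcomp Require Import all_boot all_order all_algebra.
From mathcomp Require Import all_classical all_reals topology normedtype.

Set Implicit Arguments.
Unset Strict Implicit.
Unset Printing Implicit Defensive.

Import Order.TTheory GRing.Theory Num.Theory.
Import numFieldNormedType.Exports.

Local Open Scope classical_set_scope.
Local Open Scope ring_scope.

Section Dictionary.
Context {R : realType} {X : completeNormedModType R}.

Definition lin_span (A : set X) : set X :=
  [set x | exists n (a : 'I_n -> R) (g : 'I_n -> X),
     (forall i, A (g i)) /\ x = \sum_(i < n) a i *: g i].

Definition dictionary (D : set X) : Prop :=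
  [/\ forall g, D g -> `|g| <= 1,
      closure (lin_span D) = setT
    & forall g, D g -> D (- g)].

(* Used only for continuous F, for which the set is bounded and nonempty. *)
Definition dual_norm (F : {linear X -> R^o}) : R :=
  sup [set `|F x| | x in [set x : X | `|x| <= 1]].

Definition norming (F : {linear X -> R^o}) (h : X) : Prop :=
  [/\ continuous F, dual_norm F = 1 & F h = `|h|].

Definition dict_norm (D : set X) (F : {linear X -> R^o}) : R :=
  sup [set F g | g in D].

End Dictionary.

Section Algorithms.
Context {R : realType} {X : completeNormedModType R}.
Variables (D : set X) (tau : nat -> R) (f : X).

(* A run is a pair (phi, G) of sequences.  The paper's phi_m, m >= 1, is
   [phi m]; [phi 0] and [tau 0] are never used. *)
Definition run : Type := ((nat -> X) * (nat -> X))%type.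

Definition remainder (G : nat -> X) (m : nat) : X := f - G m.

Definition selected_span (phi : nat -> X) (m : nat) : set X :=
  lin_span [set phi i | i in [set i : nat | (1 <= i <= m)%N]].

(* Norming functionals need not be unique.  "F_h" is read as "some norming
   functional of h", separately in each condition where it occurs; when h has
   only one norming functional (e.g. if the norm is smooth) this is the same
   as fixing F_h once and for all.
   In a non-smooth space biorthogonality fails for a badly chosen F_h, and the
   functional used for selection need not be the biorthogonal one: in the plane
   with the max norm, D = {(1,-1), (-1,1), (1,1), (-1,-1)}, f = (2,0), the
   choice phi_1 = (1,-1), G_1 = (1,-1) leaves f_1 = (1,1); then
   (x,y) |-> x is a norming functional of f_1 that does not vanish at G_1,
   while (x,y) |-> (x+y)/2 is one that does. *)

Definition greedy_selection (phi G : nat -> X) (m : nat) : Prop :=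
  D (phi m) /\
  (remainder G m.-1 != 0 ->
   exists F : {linear X -> R^o},
     norming F (remainder G m.-1) /\ tau m * dict_norm D F <= F (phi m)).

Definition error_reduction (phi G : nat -> X) (m : nat) : Prop :=
  `|remainder G m| <=
    inf [set `|remainder G m.-1 - l *: phi m| | l in [set l : R | 0 <= l]].

Definition biorthogonality (G : nat -> X) (m : nat) : Prop :=
  remainder G m != 0 ->
  exists F : {linear X -> R^o}, norming F (remainder G m) /\ F (G m) = 0.

Definition WBGA : set run :=
  [set r | let: (phi, G) := r in
     G 0%N = 0 /\
     forall m, (1 <= m)%N ->
       [/\ selected_span phi m (G m),
           greedy_selection phi G m,
           error_reduction phi G m
         & biorthogonality G m]].

Definition chebyshev_step (phi G : nat -> X) (m : nat) : Prop :=
  selected_span phi m (G m) /\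
  `|f - G m| = inf [set `|f - g| | g in selected_span phi m].

Definition WCGA : set run :=
  [set r | let: (phi, G) := r in
     G 0%N = 0 /\
     forall m, (1 <= m)%N -> greedy_selection phi G m /\ chebyshev_step phi G m].

Definition free_relaxation_step (phi G : nat -> X) (m : nat) : Prop :=
  let candidate (w l : R) := (1 - w) *: G m.-1 + l *: phi m in
  exists w l : R,
    [/\ 0 <= l,
        `|f - candidate w l| =
          inf [set `|f - candidate w' l'|
              | w' in [set: R] & l' in [set l' : R | 0 <= l']]
      & G m = candidate w l].

Definition WGAFR : set run :=
  [set r | let: (phi, G) := r in
     G 0%N = 0 /\
     forall m, (1 <= m)%N ->
       greedy_selection phi G m /\ free_relaxation_step phi G m].

Definition rescaled_relaxation_step (phi G : nat -> X) (m : nat) : Prop :=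
  exists l mu : R,
    [/\ 0 <= l,
        `|remainder G m.-1 - l *: phi m| =
          inf [set `|remainder G m.-1 - l' *: phi m|
              | l' in [set l' : R | 0 <= l']],
        `|f - mu *: (G m.-1 + l *: phi m)| =
          inf [set `|f - mu' *: (G m.-1 + l *: phi m)| | mu' in [set: R]]
      & G m = mu *: (G m.-1 + l *: phi m)].

Definition RWRGA : set run :=
  [set r | let: (phi, G) := r in
     G 0%N = 0 /\
     forall m, (1 <= m)%N ->
       greedy_selection phi G m /\ rescaled_relaxation_step phi G m].

End Algorithms.

(* Main.v *)
(** A norm attaining its minimum over the line [h + R g] at [h] has a norming
    functional at [h] that vanishes at [g]: extend [h |-> |h|] by Hahn-Banach
    below the seminorm [x |-> inf_s |x + s g|], which takes the value [|h|] at
    [h] and vanishes on the line [R g].  Each of the three algorithms minimizes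
    over a set of approximants containing a neighbourhood of [G_m] in the line
    [R G_m], so this applies with [h := f_m], [g := G_m]; error reduction holds
    because [G_(m-1) + l phi_m] always competes in the minimization.

    Hahn-Banach is proved without partial functionals: among sublinear
    functionals, the minimal ones are linear. *)
From HB Require Import structures.
Require Import Defs.
From mathcomp Require Import all_boot all_order all_algebra.
From mathcomp Require Import all_classical all_reals topology normedtype.
From mathcomp Require Import lra.

Import Order.TTheory GRing.Theory Num.Theory.
Import numFieldNormedType.Exports.
Local Open Scope classical_set_scope.
Local Open Scope ring_scope.

(** * Hahn-Banach theorem via minimal sublinear functionals *)

Section HahnBanach.
Context {R : realType} {V : lmodType R}.
Implicit Types (p q : V -> R) (K : set (V * R)) (x y h : V).

Definition sublinear q : Prop :=
  (forall x y, q (x + y) <= q x + q y) /\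
  (forall t x, 0 <= t -> q (t *: x) <= t * q x).

Lemma sublinear0 q : sublinear q -> q 0 = 0.
Proof.
move=> [qD qZ]; have := qD 0 0; have := qZ 0 0 (lexx _).
by rewrite scale0r addr0 mul0r; lra.
Qed.

Lemma sublinearZ q t x : sublinear q -> 0 <= t -> q (t *: x) = t * q x.
Proof.
move=> qs; rewrite le_eqVlt => /predU1P[<-|t0].
  by rewrite scale0r mul0r sublinear0.
apply/eqP; rewrite eq_le (qs.2 _ _ (ltW t0))/= -ler_pdivlMl//.
rewrite -{1}[x](scalerK (lt0r_neq0 t0)).
by rewrite qs.2// invr_ge0 ltW.
Qed.

Lemma sublinear_oppr_ge q x : sublinear q -> - q (- x) <= q x.
Proof. by move=> qs; have := qs.1 x (- x); rewrite subrr sublinear0//; lra. Qed.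

Definition convex_cone K : Prop :=
  [/\ K (0, 0), forall k l, K k -> K l -> K (k.1 + l.1, k.2 + l.2)
    & forall t k, 0 <= t -> K k -> K (t *: k.1, t * k.2)].

(** A pair [(v, c)] in [K] encodes the constraint [c <= F v]. When [q] is sublinear and dominates
    [K], the competitor [(v, c)] at [- v] gives [F (- v) <= - c] for every linear [F] below
    [cone_inf q K]. *)
Definition cone_inf q K x : R := inf [set q (x + k.1) - k.2 | k in K].

Section ConeInf.
Variables (q : V -> R) (K : set (V * R)).
Hypotheses (qs : sublinear q) (Kc : convex_cone K).
Hypothesis (qK : forall k, K k -> k.2 <= q k.1).

Lemma cone_inf_le x k : K k -> cone_inf q K x <= q (x + k.1) - k.2.
Proof.
move=> Kk; apply: ge_inf; last by exists k.
(* Lower bound: [l.2 <= q l.1 <= q (x + l.1) + q (- x)]. *)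
exists (- q (- x)) => _ [l Kl <-].
by have := qs.1 (x + l.1) (- x); have := qK _ Kl; rewrite addrAC subrr add0r; lra.
Qed.

Lemma le_cone_inf x c : (forall k, K k -> c <= q (x + k.1) - k.2) ->
  c <= cone_inf q K x.
Proof.
move=> le_c; apply: lb_le_inf => [|_ [k Kk <-]]; last exact: le_c.
by case: Kc => K0 _ _; exists (q (x + 0) - 0), (0, 0).
Qed.

Lemma cone_inf_le_id x : cone_inf q K x <= q x.
Proof. by case: Kc => /(cone_inf_le x) /=; rewrite addr0 subr0. Qed.

Lemma sublinear_cone_inf : sublinear (cone_inf q K).
Proof.
have [K0 KD KZ] := Kc; split=> [x y|t x].
  rewrite -lerBlDr; apply: le_cone_inf => k Kk.
  rewrite lerBlDr -lerBlDl; apply: le_cone_inf => l Kl.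
  have := cone_inf_le (x + y) _ (KD _ _ Kk Kl).
  by have := qs.1 (x + k.1) (y + l.1); rewrite /= addrACA; lra.
rewrite le_eqVlt => /predU1P[<-|t0].
  by rewrite scale0r mul0r (le_trans (cone_inf_le_id 0))// sublinear0.
rewrite -ler_pdivrMl//; apply: le_cone_inf => k Kk; rewrite ler_pdivrMl//.
apply: le_trans (cone_inf_le _ _ (KZ t k (ltW t0) Kk)) _ => /=.
by rewrite -scalerDr mulrBr lerD2r qs.2// ltW.
Qed.

End ConeInf.

Lemma convex_cone_line x c : convex_cone [set (s *: x, s * c) | s in [set s | 0 <= s]].
Proof.
split=> [|_ _ [s/= s0 <-] [t/= t0 <-]|t _ t0 [s/= s0 <-]].
- by exists 0 => /=; rewrite ?scale0r ?mul0r.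
- by exists (s + t); rewrite /= ?addr_ge0// scalerDl mulrDl.
- by exists (t * s); rewrite /= ?mulr_ge0// scalerA mulrA.
Qed.

Definition minimal_sublinear q : Prop :=
  sublinear q /\
  forall r, sublinear r -> (forall x, r x <= q x) -> r = q.

(** Lowering [q] along the ray of [(y, q y)] gives a sublinear functional below [q], hence [q]
    itself by minimality. Its competitor [(y, q y)] then reads [q x <= q (x + y) - q y], the
    converse of subadditivity. *)
Lemma minimal_sublinear_linear q : minimal_sublinear q ->
  linear (q : V -> R^o).
Proof.
move=> [qs qmin].
have qD x y : q (x + y) = q x + q y.
  pose K := [set (s *: y, s * q y) | s in [set s | 0 <= s]].
  have Kc : convex_cone K by exact: convex_cone_line.
  have qK k : K k -> k.2 <= q k.1.
    by move=> [s/= s0 <-]; rewrite sublinearZ.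
  apply/eqP; rewrite eq_le qs.1 /= -lerBrDr.
  rewrite -{1}(qmin _ (sublinear_cone_inf _ _ qs Kc qK)
                      (cone_inf_le_id _ _ qs Kc qK)).
  have Ky : K (y, q y) by exists 1; rewrite /= ?scale1r ?mul1r.
  exact: (cone_inf_le _ _ qs qK x _ Ky).
have qN x : q (- x) = - q x.
  by apply/eqP; rewrite -addr_eq0 -qD addNr sublinear0.
move=> t x y; rewrite qD; congr (_ + _).
have [t0|t0] := leP 0 t; first exact: sublinearZ.
by rewrite -[t]opprK scaleNr qN sublinearZ ?oppr_ge0 ?ltW// scaleNr.
Qed.

Lemma minimal_sublinear_exists p : sublinear p ->
  exists2 q, minimal_sublinear q & forall x, q x <= p x.
Proof.
move=> ps; pose T := {q | sublinear q /\ forall x, q x <= p x}.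
(* The pointwise order is reversed, so that Zorn's maximal element is a minimal functional and a
   chain is bounded by its pointwise infimum. *)
pose ge (q r : T) : bool := `[< forall x, sval r x <= sval q x >].
have [|q r s|[q qP] [r rP]||[q [qs qp]] qmin] := @Zorn T ge.
- by move=> q; apply/asboolP.
- by move=> /asboolP qr /asboolP rs; apply/asboolP => x; apply: le_trans (qr x).
- move=> /asboolP qr /asboolP rq; apply: eq_exist.
  by apply/funext => x; apply/eqP; rewrite eq_le rq qr.
- move=> A Atot; have [[q0 Aq0]|A0] := pselect (A !=set0); last first.
    by exists (exist _ p (conj ps (fun=> lexx _))) => s As; case: A0; exists s.
  pose m x := inf [set sval q x | q in A].
  have m_le (q : T) x : A q -> m x <= sval q x.
    move=> Aq; apply: ge_inf; last by exists q.
    (* This bound is uniform over the chain: [- p (- x) <= - r (- x) <= r x]. *)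
    exists (- p (- x)) => _ [r Ar <-]; have [rs rp] := svalP r.
    by have := sublinear_oppr_ge _ x rs; have := rp (- x); lra.
  have le_m x c : (forall q : T, A q -> c <= sval q x) -> c <= m x.
    move=> le_c; apply: lb_le_inf => [|_ [q Aq <-]]; last exact: le_c.
    by exists (sval q0 x), q0.
  have ms : sublinear m.
    split=> [x y|t x].
      rewrite -lerBlDr; apply: (le_m) => q Aq.
      rewrite lerBlDr -lerBlDl; apply: (le_m) => r Ar; rewrite lerBlDl.
      have [/asboolP qr|/asboolP rq] := Atot _ _ Aq Ar.
        apply: le_trans (m_le _ _ Ar) (le_trans ((svalP r).1.1 _ _) _).
        by rewrite lerD2r.
      apply: le_trans (m_le _ _ Aq) (le_trans ((svalP q).1.1 _ _) _).
      by rewrite lerD2l.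
    rewrite le_eqVlt => /predU1P[<-|t0].
      rewrite scale0r mul0r (le_trans (m_le _ _ Aq0))// sublinear0//.
      exact: (svalP q0).1.
    rewrite -ler_pdivrMl//; apply: (le_m) => q Aq; rewrite ler_pdivrMl//.
    apply: le_trans (m_le _ _ Aq) _; exact: (svalP q).1.2 (ltW t0).
  have mp x : m x <= p x by apply: le_trans (m_le _ _ Aq0) ((svalP q0).2 x).
  by exists (exist _ m (conj ms mp)) => q Aq; apply/asboolP => x; exact: m_le.
- exists q => //; split=> // r rs rq.
  have rp x : r x <= p x by exact: le_trans (rq x) (qp x).
  by apply: (congr1 sval (qmin (exist _ r (conj rs rp)) _)); exact/asboolP.
Qed.

Lemma hahn_banach p h : sublinear p ->
  exists F : {linear V -> R^o}, (forall x, F x <= p x) /\ F h = p h.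
Proof.
move=> ps; pose K := [set (s *: h, s * p h) | s in [set s | 0 <= s]].
have Kc : convex_cone K by exact: convex_cone_line.
have pK k : K k -> k.2 <= p k.1.
  by move=> [s/= s0 <-]; rewrite sublinearZ.
have [q qmin qp] := minimal_sublinear_exists _ (sublinear_cone_inf _ _ ps Kc pK).
pose qL := GRing.isLinear.Build R V R^o *:%R q (minimal_sublinear_linear _ qmin).
pose F : {linear V -> R^o} := HB.pack q qL.
have Fp x : F x <= p x by exact: le_trans (qp x) (cone_inf_le_id _ _ ps Kc pK x).
exists F; split=> //; apply/eqP; rewrite eq_le Fp /=.
(* The competitor [(h, p h)] at [- h] gives [F (- h) <= - p h], the missing inequality. *)
have Kh : K (h, p h) by exists 1; rewrite /= ?scale1r ?mul1r.
have := le_trans (qp (- h)) (cone_inf_le _ _ ps pK _ _ Kh).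
rewrite /= addNr sublinear0// sub0r -[q _]/(F (- h)) linearN lerN2; exact.
Qed.

End HahnBanach.

(** * Norming functionals and minimality along a line *)

Section Norming.
Context {R : realType} {X : completeNormedModType R}.
Implicit Types (h g : X) (l : R).

Lemma norming_of_le_norm (F : {linear X -> R^o}) h :
  h != 0 -> (forall x, F x <= `|x|) -> F h = `|h| -> norming F h.
Proof.
move=> h0 Fle Fh.
have Fnorm x : `|F x| <= `|x|.
  by rewrite ler_norml Fle andbT lerNl -linearN -[leRHS]normrN Fle.
split=> //.
- apply: bounded_linear_continuous; apply/linear_boundedP.
  exists 1; split=> // r /ltW r1 x.
  by rewrite (le_trans (Fnorm x))// ler_peMl.
- apply/eqP; rewrite eq_le; apply/andP; split.
    apply: ge_sup; first by exists `|F 0|, 0; rewrite //= normr0.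
    by move=> _ [x /= x1 <-]; exact: le_trans (Fnorm x) x1.
  apply: ub_le_sup.
    by exists 1 => _ [x /= x1 <-]; exact: le_trans (Fnorm x) x1.
  have nh0 : `|h| != 0 by rewrite normr_eq0.
  (* The value 1 is attained at the unit vector in the direction of [h]. *)
  exists (`|h|^-1 *: h); rewrite /= ?normrZ ?linearZ ?Fh /=.
    by rewrite normfV normr_id mulVf.
  by rewrite [_ *: _]mulVf// normr1.
Qed.

Lemma sublinear_norm : sublinear (fun x : X => `|x|).
Proof.
split=> [x y|t x t0]; first exact: ler_normD.
by rewrite normrZ ger0_norm.
Qed.

Lemma norming_orthogonal h g : h != 0 ->
  (forall l, `|h| <= `|h - l *: g|) ->
  exists F : {linear X -> R^o}, norming F h /\ F g = 0.
Proof.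
move=> h0 hmin.
(* A whole line with second component 0 turns [cone_inf] into the seminorm [inf_s |x + s g|]. *)
pose K := [set (s *: g, 0 : R) | s in [set: R]].
have Kc : convex_cone K.
  split=> [|_ _ [s _ <-] [t _ <-]|t _ t0 [s _ <-]].
  - by exists 0 => //; rewrite scale0r.
  - by exists (s + t) => //=; rewrite scalerDl addr0.
  - by exists (t * s) => //=; rewrite scalerA mulr0.
have nK k : K k -> k.2 <= `|k.1| by move=> [s _ <-] /=.
have Kg s : K (s *: g, 0) by exists s.
pose p := cone_inf (fun x : X => `|x|) K.
have ps : sublinear p := sublinear_cone_inf _ _ sublinear_norm Kc nK.
have p_le x s : p x <= `|x + s *: g|.
  by have := cone_inf_le _ _ sublinear_norm nK x _ (Kg s); rewrite /= subr0.
have p_norm x : p x <= `|x| := cone_inf_le_id _ _ sublinear_norm Kc nK x.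
have [F [Fp Fh]] := hahn_banach p h ps.
have Fg s : F (s *: g) <= 0.
  apply: le_trans (Fp _) (le_trans (p_le _ (- s)) _).
  by rewrite scaleNr subrr normr0.
exists F; split.
  apply: norming_of_le_norm => // [x|]; first exact: le_trans (Fp x) (p_norm x).
  apply/eqP; rewrite Fh eq_le p_norm /=.
  apply: (le_cone_inf _ _ Kc) => _ [s _ <-] /=; rewrite subr0.
  by rewrite -[s]opprK scaleNr hmin.
apply/eqP; rewrite eq_le -[g]scale1r Fg /=.
by rewrite -oppr_le0 -linearN -scaleNr Fg.
Qed.

(** By convexity of [l |-> |h - l g|], a minimum over a neighbourhood of [0] is
    global. *)
Lemma norm_line_min h g : (forall l, -1 <= l -> `|h| <= `|h - l *: g|) ->
  forall l, `|h| <= `|h - l *: g|.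
Proof.
move=> hmin l; have [l1|l1] := leP (-1) l; first exact: hmin.
(* The weight [t] places [h + g], the point of parameter -1, on the segment from [h] to
   [h - l *: g]. *)
pose t := (- l)^-1.
have t0 : 0 < t by rewrite invr_gt0; lra.
have t1 : t <= 1 by rewrite invf_le1; lra.
have tl : t * l = -1 by rewrite -[l in LHS]opprK mulrN mulVf//; lra.
have := hmin (-1) (lexx _).
have -> : h - -1 *: g = (1 - t) *: h + t *: (h - l *: g).
  by rewrite scalerBr scalerA tl scalerBl scale1r addrA subrK.
move=> /le_trans/(_ (ler_normD _ _)); rewrite !normrZ.
rewrite (ger0_norm (ltW t0)) ger0_norm ?subr_ge0// mulrBl mul1r.
by rewrite -addrA lerDl addrC subr_ge0 ler_pM2l.
Qed.

End Norming.

(** * Linear spans of the selected elements *)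

Section Span.
Context {R : realType} {X : completeNormedModType R}.
Implicit Types A B : set X.

Lemma lin_span0 A : lin_span A 0.
Proof.
by exists 0%N, (fun=> 0), (fun=> 0); split=> [[]//|]; rewrite big_ord0.
Qed.

Lemma lin_span_sub A B : A `<=` B -> lin_span A `<=` lin_span B.
Proof.
by move=> AB _ [n [a [g [Ag ->]]]]; exists n, a, g; split=> // i; exact: AB.
Qed.

Lemma lin_span_mem A x : A x -> lin_span A x.
Proof.
by move=> Ax; exists 1%N, (fun=> 1), (fun=> x); split=> //; rewrite big_ord1 scale1r.
Qed.

Lemma lin_spanZ A c x : lin_span A x -> lin_span A (c *: x).
Proof.
move=> [n [a [g [Ag ->]]]]; exists n, (fun i => c * a i), g; split=> //.
by rewrite scaler_sumr; apply: eq_bigr => i _; rewrite scalerA.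
Qed.

Lemma lin_spanD A x y : lin_span A x -> lin_span A y -> lin_span A (x + y).
Proof.
move=> [n [a [g [Ag ->]]]] [m [b [h [Ah ->]]]].
exists (n + m)%N,
  (fun i => match fintype.split i with inl j => a j | inr j => b j end),
  (fun i => match fintype.split i with inl j => g j | inr j => h j end); split.
  by move=> i; case: fintype.splitP.
rewrite big_split_ord; congr (_ + _); apply: eq_bigr => i _.
  by rewrite -[lshift _ _]/(unsplit (inl i)) unsplitK.
by rewrite -[rshift _ _]/(unsplit (inr i)) unsplitK.
Qed.

Lemma selected_span_relax (phi : nat -> X) m g a b : (1 <= m)%N ->
  selected_span phi m.-1 g -> selected_span phi m (a *: g + b *: phi m).
Proof.
move=> m1 gspan; apply: lin_spanD; apply: lin_spanZ.
  apply: lin_span_sub gspan => _ [i /= /andP[i1 im] <-]; exists i => //=.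
  by rewrite i1 (leq_trans im)// leq_pred.
by apply: lin_span_mem; exists m; rewrite //= m1 leqnn.
Qed.

End Span.

(** * Membership of the three algorithms in the class *)

Section Algorithms.
Context {R : realType} {X : completeNormedModType R}.
Variables (D : set X) (tau : nat -> R) (f : X).

Lemma inf_norm_le {T : Type} (S : set T) (u : T -> X) (i : T) :
  S i -> inf [set `|u j| | j in S] <= `|u i|.
Proof.
by move=> Si; apply: ge_inf; [exists 0 => _ [j _ <-]|exists i].
Qed.

Lemma error_reduction_of_le (phi G : nat -> X) m :
  (forall l, 0 <= l -> `|f - G m| <= `|f - (G m.-1 + l *: phi m)|) ->
  error_reduction f phi G m.
Proof.
move=> Gmin; apply: lb_le_inf.
  by exists `|remainder f G m.-1 - 0 *: phi m|, 0 => //=.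
by move=> _ [l /= l0 <-]; rewrite /remainder -addrA -opprD Gmin.
Qed.

(** Only factors [l >= 0] are required, since free relaxation allows no negative coefficient of
    [phi m]. They still surround [l = 1], that is, [G m] itself. *)
Lemma biorthogonality_of_le (G : nat -> X) m :
  (forall l, 0 <= l -> `|f - G m| <= `|f - l *: G m|) ->
  biorthogonality f G m.
Proof.
move=> Gmin fm0; apply: norming_orthogonal => //; apply: norm_line_min => l l1.
rewrite /remainder -addrA -opprD -{2}[G m]scale1r -scalerDl Gmin//; lra.
Qed.

Lemma WCGA_sub_WBGA : WCGA D tau f `<=` WBGA D tau f.
Proof.
move=> [phi G] [G0 step]; split=> // m m1; have [sel [Gspan Gmin]] := step m m1.
have Gle g : selected_span phi m g -> `|f - G m| <= `|f - g|.
  by move=> gspan; rewrite Gmin (inf_norm_le _ (fun g => f - g)).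
split=> //.
- apply: error_reduction_of_le => l _; apply: Gle.
  rewrite -[G m.-1]scale1r; apply: selected_span_relax => //.
  (* The step condition starts at index 1, so the span membership of [G 0] comes from [G 0 = 0]. *)
  case: m m1 {sel Gspan Gmin} => [//|[|m]] _ /=.
    by rewrite G0; exact: lin_span0.
  by have [_ []] := step m.+1 isT.
- by apply: biorthogonality_of_le => l _; apply/Gle/lin_spanZ.
Qed.

Lemma selected_span_of_relax (phi G : nat -> X) : G 0%N = 0 ->
  (forall m, (1 <= m)%N -> exists a b, G m = a *: G m.-1 + b *: phi m) ->
  forall m, selected_span phi m (G m).
Proof.
move=> G0 step; elim=> [|m IH]; first by rewrite G0; exact: lin_span0.
by have [a [b ->]] := step m.+1 isT; exact: selected_span_relax.
Qed.

Lemma WGAFR_sub_WBGA : WGAFR D tau f `<=` WBGA D tau f.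
Proof.
move=> [phi G] [G0 step]; split=> // m m1.
have [sel [w [l [l0 Gmin Gm]]]] := step m m1.
have Gle w' l' : 0 <= l' ->
    `|f - G m| <= `|f - ((1 - w') *: G m.-1 + l' *: phi m)|.
  move=> l'0; rewrite Gm Gmin; apply: ge_inf; last by exists w' => //; exists l'.
  by exists 0 => _ [? _ [? _ <-]].
split=> //.
- apply: selected_span_of_relax => // k /step[_ [a [b [_ _ ->]]]].
  by exists (1 - a), b.
- apply: error_reduction_of_le => l' l'0.
  by have := Gle 0 l' l'0; rewrite subr0 scale1r.
- apply: biorthogonality_of_le => s s0.
  (* These parameters make the candidate equal to [s *: G m]. *)
  have := Gle (1 - s * (1 - w)) (s * l) (mulr_ge0 s0 l0).
  by rewrite subKr -!scalerA -scalerDr -Gm.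
Qed.

Lemma RWRGA_sub_WBGA : RWRGA D tau f `<=` WBGA D tau f.
Proof.
move=> [phi G] [G0 step]; split=> // m m1.
have [sel [l [mu [l0 lmin mumin Gm]]]] := step m m1.
have Gle s : `|f - G m| <= `|f - s *: (G m.-1 + l *: phi m)|.
  by rewrite Gm mumin (inf_norm_le _ (fun s => f - s *: _)).
split=> //.
- apply: selected_span_of_relax => // k /step[_ [a [b [_ _ _ ->]]]].
  by exists b, (b * a); rewrite scalerDr scalerA.
(* Rescaling by 1 competes, and the unscaled remainder already attains the infimum over [l]. *)
- rewrite /error_reduction -lmin (le_trans (Gle 1))// scale1r.
  by rewrite /remainder opprD addrA.
- by apply: biorthogonality_of_le => s _; rewrite {2}Gm scalerA.
Qed.

End Algorithms.

Theorem proposition4p1 (R : realType) (X : completeNormedModType R)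
    (D : set X) (hD : dictionary D)
    (tau : nat -> R) (htau : forall m : nat, (1 <= m)%N -> 0 <= tau m <= 1)
    (f : X) :
  [/\ WCGA D tau f `<=` WBGA D tau f,
      WGAFR D tau f `<=` WBGA D tau f
    & RWRGA D tau f `<=` WBGA D tau f].
Proof.
split; [exact: WCGA_sub_WBGA | exact: WGAFR_sub_WBGA | exact: RWRGA_sub_WBGA].
Qed.
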